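(* Any deterministic algorithm (in the comparison-based model described in the context) that correctly decides, for every sequence $P$ of $n$ points in $\mathbb{R}^2$, whether $P$ fulfils the convex hull promise, requires $\Omega(n\log n)$ comparisons in the worst case.
   Context: For a sequence $P=(p_1,\dots,p_n)$ of points in $\mathbb{R}^2$, $\mathrm{index}(p_i)=i$ and $x(p)$ is the $x$-coordinate of $p$. $P$ fulfils the convex hull promise if for any two points $p,q$ of $P$ lying on the convex hull (i.e. convex hull vertices), $\mathrm{index}(p)<\mathrm{index}(q)\iff x(p)<x(q)$. Model of computation. For each fixed input size, an algorithm specifies a (RAM) programme, i.e. a list of instructions. Instructions can manipulate memory, halt the programme, or make comparisons. There are two types of comparisons: (i) coordinate comparisons, comparing the $x$-coordinates or the $y$-coordinates of two input points $p_i,p_j$; (ii) orientation tests, evaluating whether an input point $p_k$ lies strictly above the line through two input points $p_i,p_j$. A comparison returns a Boolean; if true, the programme jumps to an instruction specified by the algorithm, and otherwise continues with the next instruction. Non-comparison instructions have inputs defined independently of the input points (coordinates cannot be manipulated). *)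

(* Defs.v *)
From mathcomp Require Export all_boot all_order all_algebra.
From mathcomp Require Export all_classical all_reals all_analysis.

Set Implicit Arguments.
Unset Strict Implicit.
Unset Printing Implicit Defensive.

Import Order.TTheory GRing.Theory Num.Theory.

Local Open Scope classical_set_scope.
Local Open Scope ring_scope.

Definition xcoord (R : realType) (p : 'rV[R]_2) : R := p 0 0.
Definition ycoord (R : realType) (p : 'rV[R]_2) : R := p 0 1.

Definition convex_hull (R : realType) (S : set 'rV[R]_2) : set 'rV[R]_2 :=
  smallest (@convex_set R 'rV[R]_2) S.

Definition extreme_point (R : realType) (C : set 'rV[R]_2) (p : 'rV[R]_2) :=
  C p /\ forall (a b : 'rV[R]_2) (t : R), C a -> C b -> 0 < t < 1 ->
    p = t *: a + (1 - t) *: b -> a = p /\ b = p.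

(* The vertices of the hull polygon are its extreme points: a point in the
   relative interior of a hull edge is not a vertex. The predicate is on
   indices, so a vertex occurring several times in P counts at each of its
   indices. *)
Definition hull_vertex (R : realType) n (P : 'I_n -> 'rV[R]_2) (i : 'I_n) :=
  extreme_point (convex_hull (range P)) (P i).

Definition convex_hull_promise (R : realType) n (P : 'I_n -> 'rV[R]_2) : Prop :=
  forall i j : 'I_n, hull_vertex P i -> hull_vertex P j ->
    ((i < j)%N <-> xcoord (P i) < xcoord (P j)).

(* A vertical line, or a pair of coinciding points, has no point strictly above
   it: the test then answers false. *)
Definition strictly_above (R : realType) (p q r : 'rV[R]_2) : bool :=
  (xcoord p != xcoord q) &&
  (ycoord p + (ycoord q - ycoord p) / (xcoord q - xcoord p)
                * (xcoord r - xcoord p) < ycoord r).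

Inductive cmp_rel := CmpLt | CmpLe | CmpEq.

Definition eval_rel (R : realType) (r : cmp_rel) (u v : R) : bool :=
  match r with
  | CmpLt => u < v
  | CmpLe => u <= v
  | CmpEq => u == v
  end.

Inductive comparison (n : nat) :=
| CompareX of cmp_rel & 'I_n & 'I_n
| CompareY of cmp_rel & 'I_n & 'I_n
| Orientation of 'I_n & 'I_n & 'I_n.

(* [Orientation n i j k] tests whether point k is above the line through
   points i and j. *)
Definition eval_comparison (R : realType) n (P : 'I_n -> 'rV[R]_2)
    (c : comparison n) : bool :=
  match c with
  | CompareX r i j => eval_rel r (xcoord (P i)) (xcoord (P j))
  | CompareY r i j => eval_rel r (ycoord (P i)) (ycoord (P j))
  | Orientation i j k => strictly_above (P i) (P j) (P k)
  end.

Definition memory := nat -> nat.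

(* The points are not stored in memory, so an arbitrary transformation of the
   memory has no access to coordinates. Which points are compared may be read
   from memory (indirect addressing). *)
Inductive instruction (n : nat) :=
| Manipulate of memory -> memory
| Halt
| Compare of memory -> comparison n & nat.

Definition programme (n : nat) := seq (instruction n).

(* [exec prog P pc m b k]: started at instruction pc with memory m, prog halts
   with answer b (register 0 is nonzero) after exactly k comparisons. Leaving
   the list of instructions is not halting. *)
Inductive exec (R : realType) (n : nat) (prog : programme n)
    (P : 'I_n -> 'rV[R]_2) : nat -> memory -> bool -> nat -> Prop :=
| exec_halt pc m :
    onth prog pc = Some (Halt n) ->
    exec prog P pc m (m 0%N != 0%N) 0
| exec_manipulate pc m f b k :
    onth prog pc = Some (Manipulate n f) ->
    exec prog P pc.+1 (f m) b k ->
    exec prog P pc m b k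
| exec_compare pc m c target b k :
    onth prog pc = Some (Compare c target) ->
    exec prog P (if eval_comparison P (c m) then target else pc.+1) m b k ->
    exec prog P pc m b k.+1.

Definition run (R : realType) n (prog : programme n) (P : 'I_n -> 'rV[R]_2)
    (answer : bool) (comparisons : nat) : Prop :=
  exec prog P 0 (fun=> 0%N) answer comparisons.

Definition decides_promise (R : realType) n (prog : programme n) : Prop :=
  forall P : 'I_n -> 'rV[R]_2, exists (answer : bool) (k : nat),
    run prog P answer k /\ (answer <-> convex_hull_promise P).

(* Main.v *)
(** Put the vertices v_a = (2a, 4a^2) on a parabola, in index order, followed
    by m points q_l; a permutation s says near the midpoint of which edge
    v_(s l) v_(s l + 1) the point q_l lies. Slightly inside the hull the q_l are
    irrelevant and the promise holds; pushing one q_l slightly outside makes it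
    a vertex that comes too late in the sequence. The only comparison that
    notices the push is the orientation test on {v_(s l), v_(s l + 1), q_l}, so
    a correct run on the configuration of s performs this test for every l.
    Hence s can be read off the sequence of answers together with one mark per
    comparison telling whether it is such a test, and m! is at most 5^k, where k
    is the maximal number of comparisons. *)

From mathcomp Require Import all_fingroup ring lra zify.
Require Import Defs.

Set Implicit Arguments.
Unset Strict Implicit.
Unset Printing Implicit Defensive.

Import Order.TTheory GRing.Theory Num.Theory.
Local Open Scope classical_set_scope.
Local Open Scope ring_scope.

(** * Extreme points of hulls *)

Lemma convex_hull_in (R : realType) (S : set 'rV[R]_2) (p : 'rV[R]_2) :
  S p -> convex_hull S p.
Proof. by move=> Sp A [_]; apply. Qed.

Lemma convex_hull_conv (R : realType) (S : set 'rV[R]_2) (a b : 'rV[R]_2) (t : R) :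
  convex_hull S a -> convex_hull S b -> 0 <= t <= 1 ->
  convex_hull S (t *: a + (1 - t) *: b).
Proof.
move=> Sa Sb /andP[t0 t1] A AS; have [cA _] := AS.
have t01 : Itv.spec (@Itv.num_sem R) (Itv.Real `[0, 1]%Z) t.
  by apply/and3P; split; rewrite ?num_real// bnd_simp.
have := cA a b (Itv.mk t01).
by rewrite !inE; apply; [exact: Sa|exact: Sb].
Qed.

Lemma convex_hull_sub (R : realType) (S C : set 'rV[R]_2) :
  (forall (a b : 'rV[R]_2) (t : R), C a -> C b -> 0 < t < 1 ->
    C (t *: a + (1 - t) *: b)) ->
  S `<=` C -> convex_hull S `<=` C.
Proof.
move=> cC SC; apply: smallest_sub => //; apply/convex_setW => a b.
rewrite !inE => Ca Cb t t0 t1; rewrite inE.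
by apply: cC => //; rewrite t0.
Qed.

Lemma point_conv (R : realType) (t : R) (a b : 'rV[R]_2) :
  (xcoord (t *: a + (1 - t) *: b) = t * xcoord a + (1 - t) * xcoord b) *
  (ycoord (t *: a + (1 - t) *: b) = t * ycoord a + (1 - t) * ycoord b).
Proof. by rewrite /xcoord /ycoord !mxE. Qed.

Lemma point_eq (R : realType) (p q : 'rV[R]_2) :
  xcoord p = xcoord q -> ycoord p = ycoord q -> p = q.
Proof.
move=> ex ey; apply/rowP => -[[|[|//]] lt].
- by move: ex; rewrite /xcoord; congr (p _ _ = q _ _); apply: val_inj.
- by move: ey; rewrite /ycoord; congr (p _ _ = q _ _); apply: val_inj.
Qed.

(** [P i] together with the open half-plane where the functional exceeds its value at [P i] is
    convex and contains every point, hence the hull; in it [P i] is a proper convex combination of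
    itself only. *)
Lemma hull_vertex_support (R : realType) n (P : 'I_n -> 'rV[R]_2) (i : 'I_n)
    (a b : R) :
  (forall j, j != i -> a * xcoord (P i) + b * ycoord (P i) <
                       a * xcoord (P j) + b * ycoord (P j)) ->
  hull_vertex P i.
Proof.
move=> minP; split; first by apply: convex_hull_in; exists i.
pose f (p : 'rV[R]_2) := a * xcoord p + b * ycoord p.
pose C := [set p : 'rV[R]_2 | p = P i \/ f (P i) < f p].
have f_conv (t : R) p q :
  f (t *: p + (1 - t) *: q) = t * f p + (1 - t) * f q.
  by rewrite /f !point_conv; ring.
have f_min (p q : 'rV[R]_2) t : C p -> C q -> 0 < t < 1 ->
    f (t *: p + (1 - t) *: q) <= f (P i) -> p = P i /\ q = P i.
  move=> Cp Cq /andP[t0 t1]; rewrite f_conv.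
  have t1' : 0 < 1 - t by rewrite subr_gt0.
  case: Cp => [->|fp']; case: Cq => [->|fq'] // le_f; exfalso.
  - by have := mulr_gt0 t1' (etrans (subr_gt0 _ _) fq'); lra.
  - by have := mulr_gt0 t0 (etrans (subr_gt0 _ _) fp'); lra.
  - have := mulr_gt0 t0 (etrans (subr_gt0 _ _) fp').
    by have := mulr_gt0 t1' (etrans (subr_gt0 _ _) fq'); lra.
have hullC : convex_hull (range P) `<=` C.
  apply: convex_hull_sub => [p q t Cp Cq t01|_ [j _ <-]].
    case: (ltP (f (P i)) (f (t *: p + (1 - t) *: q))) => [|le_f]; first by right.
    left; have [-> ->] := f_min _ _ _ Cp Cq t01 le_f.
    by rewrite -scalerDl addrCA subrr addr0 scale1r.
  by have [->|ji] := eqVneq j i; [left|right; apply: minP].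
move=> p q t /hullC Cp /hullC Cq t01 e.
by have [|-> ->] := f_min _ _ _ Cp Cq t01; first by rewrite -e.
Qed.

Lemma not_hull_vertex_between (R : realType) n (P : 'I_n -> 'rV[R]_2) (i : 'I_n)
    (p q : 'rV[R]_2) :
  convex_hull (range P) p -> convex_hull (range P) q ->
  xcoord p = xcoord (P i) -> xcoord q = xcoord (P i) ->
  ycoord p < ycoord (P i) < ycoord q -> ~ hull_vertex P i.
Proof.
move=> hp hq xp xq /andP[yp yq] [_ ext].
pose t := (ycoord q - ycoord (P i)) / (ycoord q - ycoord p).
have d0 : 0 < ycoord q - ycoord p by lra.
have t01 : 0 < t < 1 by rewrite /t ltr_pdivrMr// mul1r divr_gt0//=; lra.
have [] := ext p q t hp hq t01; last by move=> pP; rewrite pP ltxx in yp.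
apply: point_eq; rewrite point_conv ?xp ?xq; first ring.
by rewrite /t; field; rewrite gt_eqF.
Qed.

(** * Traces *)

(** The comparisons are recorded as instantiated by the memory, so that they can be evaluated again
    on another input. *)
Inductive exec_trace (R : realType) (n : nat) (prog : programme n)
    (P : 'I_n -> 'rV[R]_2) : nat -> memory -> bool -> seq (comparison n) -> Prop :=
| trace_halt pc m :
    onth prog pc = Some (Halt n) ->
    exec_trace prog P pc m (m 0%N != 0%N) [::]
| trace_manipulate pc m f b tr :
    onth prog pc = Some (Manipulate n f) ->
    exec_trace prog P pc.+1 (f m) b tr ->
    exec_trace prog P pc m b tr
| trace_compare pc m c target b tr :
    onth prog pc = Some (Compare c target) ->
    exec_trace prog P (if eval_comparison P (c m) then target else pc.+1) m b tr ->
    exec_trace prog P pc m b (c m :: tr).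

Lemma exec_exec_trace (R : realType) n (prog : programme n) (P : 'I_n -> 'rV[R]_2)
    pc m b k :
  exec prog P pc m b k -> exists2 tr, exec_trace prog P pc m b tr & size tr = k.
Proof.
elim=> {pc m b k} [pc m hH|pc m f b k hM _ [tr ht <-]|pc m c tg b k hC _ [tr ht <-]].
- by exists [::] => //; apply: trace_halt.
- by exists tr => //; apply: trace_manipulate hM ht.
- by exists (c m :: tr) => //; apply: trace_compare hC ht.
Qed.

(** The input enters a run only through the answers. *)
Lemma exec_trace_exec (R : realType) n (prog : programme n)
    (P Q : 'I_n -> 'rV[R]_2) pc m b tr :
  exec_trace prog P pc m b tr ->
  [seq eval_comparison P c | c <- tr] = [seq eval_comparison Q c | c <- tr] ->
  exec prog Q pc m b (size tr).
Proof.
elim=> {pc m b tr} [pc m hH|pc m f b k hM _ IH|pc m c tg b tr hC _ IH] /=.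
- by move=> _; apply: exec_halt.
- by move=> /IH; apply: exec_manipulate.
- by move=> [ec /IH]; rewrite ec; apply: exec_compare.
Qed.

Lemma exec_det (R : realType) n (prog : programme n) (P : 'I_n -> 'rV[R]_2)
    pc m b k b' k' :
  exec prog P pc m b k -> exec prog P pc m b' k' -> b = b' /\ k = k'.
Proof.
move=> e; elim: e b' k' => {pc m b k}
  [pc m hH|pc m f b k hM _ IH|pc m c tg b k hC _ IH] b' k' e;
  inversion e; subst => //; try congruence.
- by (have ? : f0 = f by congruence); subst; apply: IH.
- have ? : c0 = c by congruence.
  have ? : target = tg by congruence.
  by subst; have [-> ->] := IH _ _ H0.
Qed.

(** Equal answers keep both runs at the same instruction with the same memory, so the answers alone
    encode the trace. *)
Lemma exec_trace_inj (R : realType) n (prog : programme n)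
    (P Q : 'I_n -> 'rV[R]_2) pc m b tr b' tr' :
  exec_trace prog P pc m b tr -> exec_trace prog Q pc m b' tr' ->
  [seq eval_comparison P c | c <- tr] = [seq eval_comparison Q c | c <- tr'] ->
  tr = tr'.
Proof.
move=> e; elim: e b' tr' => {pc m b tr}
  [pc m hH|pc m f b tr hM _ IH|pc m c tg b tr hC _ IH] b' tr' e;
  inversion e; subst => //; try congruence.
- by (have ? : f0 = f by congruence); subst; apply: IH; eassumption.
- move=> /= [ec et].
  have ? : c0 = c by congruence.
  have ? : target = tg by congruence.
  by subst; congr cons; apply: IH et; rewrite ec; exact: H0.
Qed.

(** * Points on two parabolas *)

(* Vertices lie on y = x^2 at even abscissas, so the midpoints of the hull edges
   lie on y = x^2 + 1 at odd abscissas. *)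
Definition lattice_height (x : nat) : nat := (x ^ 2 + odd x)%N.

Definition lattice_det (a b c : nat) : int :=
  ((lattice_height c)%:Z - (lattice_height a)%:Z) * (b%:Z - a%:Z) -
  ((lattice_height b)%:Z - (lattice_height a)%:Z) * (c%:Z - a%:Z).

(* Up to sign and a nonzero difference of abscissas, the determinant is u v,
   u v - 1 or u v + 1 for nonzero differences u, v of abscissas, depending on
   parities. In the second case u and v are distinct, so u v <> 1; in the third,
   u v = -1 puts the odd abscissa between two consecutive even ones. *)
Lemma lattice_det_eq0 (a b c : nat) :
  a != b -> a != c -> b != c -> lattice_det a b c = 0 ->
  exists e, all [in [:: e.*2; e.*2.+1; e.*2.+2]] [:: a; b; c].
Proof.
move=> ab ac bc d0.
(* The squares give a Vandermonde product, the parities a linear correction. *)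
have fact : (b%:Z - a%:Z) * (c%:Z - a%:Z) * (c%:Z - b%:Z) +
    (odd c)%:Z * (b%:Z - a%:Z) - (odd b)%:Z * (c%:Z - a%:Z) +
    (odd a)%:Z * (c%:Z - b%:Z) = 0.
  by rewrite -d0 /lattice_det /lattice_height !PoszD !PoszM /=; ring.
have {}ab : b%:Z - a%:Z != 0 by lia.
have {}ac : c%:Z - a%:Z != 0 by lia.
have {}bc : c%:Z - b%:Z != 0 by lia.
have abs1 (x y : int) : `|(x * y)%R|%N = 1%N -> (x = 1 \/ x = -1) /\ (y = 1 \/ y = -1).
  by rewrite abszM => /eqP; rewrite muln_eq1 => /andP[/eqP ? /eqP ?]; lia.
have unitM (x y : int) : x * y = 1 -> x = y.
  by move=> xy; have [|[xE|xE] [yE|yE]] := abs1 x y; first rewrite xy; subst.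
have unitN (x y : int) : x * y = -1 -> (x = 1 /\ y = -1) \/ (x = -1 /\ y = 1).
  by move=> xy; have [|[xE|xE] [yE|yE]] := abs1 x y; first rewrite xy; subst; auto.
have cancel (x y : int) : x != 0 -> x * y = 0 -> y = 0.
  by move=> /negPf x0 /eqP; rewrite mulf_eq0 x0 => /eqP.
have pairM (x y z : int) : x = y - z -> x != 0 -> x * (y * z - 1) = 0 -> False.
  move=> xE x0 /(cancel _ _ x0) /subr0_eq /unitM yz.
  by move: x0; rewrite xE yz subrr eqxx.
have oddE := odd_double_half.
(* If all parities agree, the correction cancels and a product of nonzero differences remains. *)
case oa: (odd a) fact; case ob: (odd b); case oc: (odd c);
  rewrite ?mul1r ?mul0r ?addr0 ?subr0 => fact; try (exfalso;
  move: (mulf_neq0 (mulf_neq0 ab ac) bc) => /eqP; apply; lia).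
- by case: (@pairM (b%:Z - a%:Z) (c%:Z - a%:Z) (c%:Z - b%:Z)) => //; nia.
- by case: (@pairM (a%:Z - c%:Z) (b%:Z - c%:Z) (b%:Z - a%:Z)) => //; nia.
(* Only [a] is odd: it lies midway between the two even abscissas, the smaller of which is
   [e.*2]. *)
- have /(cancel _ _ bc)/subr0_eq :
   (c%:Z - b%:Z) * ((b%:Z - a%:Z) * (c%:Z - a%:Z) - (-1)) = 0 by rewrite -fact; ring.
  move=> /unitN u; exists (minn b c)./2; rewrite /= !inE.
  have := oddE b; have := oddE c; lia.
- by case: (@pairM (c%:Z - b%:Z) (c%:Z - a%:Z) (b%:Z - a%:Z)) => //; nia.
- have /(cancel _ _ ac)/subr0_eq :
   (c%:Z - a%:Z) * ((b%:Z - a%:Z) * (b%:Z - c%:Z) - (-1)) = 0 by lia.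
  move=> /unitN u; exists (minn a c)./2; rewrite /= !inE.
  have := oddE a; have := oddE c; lia.
- have /(cancel _ _ ab)/subr0_eq :
   (b%:Z - a%:Z) * ((c%:Z - a%:Z) * (c%:Z - b%:Z) - (-1)) = 0 by lia.
  move=> /unitN u; exists (minn a b)./2; rewrite /= !inE.
  have := oddE a; have := oddE b; lia.
Qed.

(** A nonzero integer is at distance at least 1 from 0. *)
Lemma int_perturb_gt0 (R : realType) (d : int) (p : R) :
  d != 0 -> `|p| < 1 -> (0 < d%:~R + p) = (0 < d).
Proof.
rewrite ltr_norml neq_lt => /orP[d0|d0] /andP[p1 p2].
- have : (d%:~R : R) <= -1 by rewrite (_ : -1 = (-1)%:~R) // ler_int; lia.
  by move=> ?; rewrite !ltNge (ltW d0) /=; apply/negbTE; rewrite negbK; lra.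
- have : 1 <= (d%:~R : R) by rewrite (_ : 1 = 1%:~R) // ler_int; lia.
  by move=> ?; rewrite d0; lra.
Qed.

(** Multiplying by the squared difference of abscissas removes the division; a vertical line yields
    0 < 0, in agreement with the default answer false. *)
Lemma strictly_above_det (R : realType) (p q r : 'rV[R]_2) :
  strictly_above p q r =
  (0 < ((ycoord r - ycoord p) * (xcoord q - xcoord p) -
        (ycoord q - ycoord p) * (xcoord r - xcoord p)) * (xcoord q - xcoord p)).
Proof.
rewrite /strictly_above; have [->|pq] /= := eqVneq (xcoord p) (xcoord q).
  by rewrite subrr mulr0 ltxx.
have d0 : xcoord q - xcoord p != 0 by rewrite subr_eq0 eq_sym.
have d2 : 0 < (xcoord q - xcoord p) ^+ 2 by rewrite exprn_even_gt0.
rewrite -subr_gt0 -(pmulr_lgt0 _ d2).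
by congr (0 < _); field.
Qed.

Definition point (R : realType) (x y : R) : 'rV[R]_2 :=
  \row_j (if j == 0 then x else y).

Lemma xcoord_point (R : realType) (x y : R) : xcoord (point x y) = x.
Proof. by rewrite /xcoord mxE. Qed.

Lemma ycoord_point (R : realType) (x y : R) : ycoord (point x y) = y.
Proof. by rewrite /ycoord mxE. Qed.

(** The parity factor keeps the hull vertices fixed: only the points near edge midpoints are
    shifted, upwards being into the hull. *)
Definition config (R : realType) n (X : 'I_n -> nat) (e : 'I_n -> R) (i : 'I_n) :=
  point (X i)%:R ((lattice_height (X i))%:R + (odd (X i))%:R * e i).

Lemma lattice_height_lt (a b : nat) : (a < b)%N -> (lattice_height a < lattice_height b)%N.
Proof. by rewrite /lattice_height => ab; nia. Qed.

Lemma lattice_height_inj : injective lattice_height.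
Proof.
by move=> a b h; case: (ltngtP a b) => // /lattice_height_lt; rewrite h ltnn.
Qed.

Lemma ycoord_config_lt (R : realType) n (X : 'I_n -> nat) (e : 'I_n -> R)
    (d : R) (i j : 'I_n) :
  (forall i, `|e i| <= d) -> 2%:R * d < 1 -> X i != X j ->
  (ycoord (config X e i) < ycoord (config X e j)) =
  (lattice_height (X i) < lattice_height (X j))%N.
Proof.
move=> ed d1 ij; rewrite !ycoord_point -subr_gt0.
set h := lattice_height; set oi : R := _%:R * e i; set oj : R := _%:R * e j.
have oP k : `|(odd (X k))%:R * e k| <= d.
  case: (odd _); rewrite ?mul1r ?mul0r ?normr0 //.
  by rewrite (le_trans _ (ed k)).
have -> : (h (X j))%:R + oj - ((h (X i))%:R + oi) =
  ((h (X j))%:Z - (h (X i))%:Z)%:~R + (oj - oi) by rewrite intrB /=; ring.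
rewrite int_perturb_gt0; first by lia.
- by have := contra_neq (@lattice_height_inj (X i) (X j)) ij; rewrite -/h; lia.
- rewrite (le_lt_trans (ler_normB _ _)) // (le_lt_trans (lerD (oP j) (oP i))) //.
  by rewrite -mulr2n -mulr_natl.
Qed.

Lemma det_config (R : realType) n (X : 'I_n -> nat) (e : 'I_n -> R)
    (d : R) (B : nat) (i j k : 'I_n) :
  (forall i, (X i <= B)%N) ->
  (forall i, `|e i| <= d) -> 3%:R * d * B%:R < 1 ->
  lattice_det (X i) (X j) (X k) != 0 -> X i != X j ->
  strictly_above (config X e i) (config X e j) (config X e k) =
  (0 < lattice_det (X i) (X j) (X k) * ((X j)%:Z - (X i)%:Z)).
Proof.
move=> XB ed d1 det0 ij.
have oP l : `|(odd (X l))%:R * e l| <= d.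
  case: (odd _); rewrite ?mul1r ?mul0r ?normr0 //.
  by rewrite (le_trans _ (ed l)).
rewrite strictly_above_det !xcoord_point !ycoord_point.
have := oP i; have := oP j; have := oP k.
set oi : R := _ * e i; set oj : R := _ * e j; set ok : R := _ * e k.
move=> okP ojP oiP.
(* The determinant is linear in the heights, so this is the exact contribution of the shifts; each
   summand is at most [d * B] in absolute value. *)
pose p : R := ok * ((X j)%:R - (X i)%:R) + oj * ((X i)%:R - (X k)%:R) +
          oi * ((X k)%:R - (X j)%:R).
have distB l l' : `|(X l)%:R - (X l')%:R : R| <= B%:R.
  have := XB l; have := XB l'; rewrite -!(ler_nat R) ler_norml.
  have := ler0n R (X l); have := ler0n R (X l').
  by move=> *; apply/andP; split; lra.
have pP : `|p| < 1.
  apply: le_lt_trans d1; rewrite (le_trans (ler_normD _ _))//.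
  have -> : 3%:R * d * B%:R = d * B%:R + d * B%:R + d * B%:R by ring.
  by rewrite lerD ?(le_trans (ler_normD _ _)) ?lerD // normrM ler_pM.
have XE : (X j)%:R - (X i)%:R = ((X j)%:Z - (X i)%:Z)%:~R :> R by rewrite intrB.
have sub0 : (X j)%:Z - (X i)%:Z != 0 by lia.
set D := lattice_det _ _ _ in det0 *.
have -> : ((lattice_height (X k))%:R + ok - ((lattice_height (X i))%:R + oi)) *
   ((X j)%:R - (X i)%:R) -
   ((lattice_height (X j))%:R + oj - ((lattice_height (X i))%:R + oi)) *
   ((X k)%:R - (X i)%:R) = D%:~R + p.
  by rewrite /D /lattice_det /p !(intrB, intrM) /=; ring.
rewrite XE; have [neg|pos|/eqP] := ltgtP ((X j)%:Z - (X i)%:Z) 0.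
- rewrite !nmulr_lgt0 ?ltrz0 // -oppr_gt0 opprD -intrN int_perturb_gt0 ?normrN //.
    by rewrite oppr_gt0.
  by rewrite oppr_eq0.
- by rewrite !pmulr_lgt0 ?ltr0z // int_perturb_gt0.
- by rewrite (negPf sub0).
Qed.

(** Abscissas are not shifted, distinct heights stay in order, and tests with a repeated point are
    always false. What remains are triples whose lattice determinant vanishes. *)
Lemma eval_comparison_config (R : realType) n (X : 'I_n -> nat)
    (e e' : 'I_n -> R) (d : R) (B : nat) (c : comparison n) :
  injective X -> (0 < B)%N -> (forall i, (X i <= B)%N) ->
  (forall i, `|e i| <= d) -> (forall i, `|e' i| <= d) ->
  3%:R * d * B%:R < 1 ->
  eval_comparison (config X e) c != eval_comparison (config X e') c ->
  exists i j k a, [/\ c = Orientation i j k, uniq [:: i; j; k] &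
    all [in [:: a.*2; a.*2.+1; a.*2.+2]] [:: X i; X j; X k]].
Proof.
move=> Xinj B0 XB ed e'd dB; case: c => [r i j|r i j|i j k] /=.
- by rewrite !xcoord_point eqxx.
- have d2 : 2%:R * d < 1.
    apply: le_lt_trans dB; have := le_trans (normr_ge0 _) (ed i) => d0.
    have : 1 <= B%:R :> R by rewrite ler1n.
    nra.
  have [->|ij] := eqVneq i j; first by rewrite /eval_rel; case: r; rewrite ?ltxx ?lexx ?eqxx.
  have Xij : X i != X j by rewrite (inj_eq Xinj).
  have Xji : X j != X i by rewrite eq_sym.
  have E f : (forall i, `|f i| <= d) ->
      eval_rel r (ycoord (config X f i)) (ycoord (config X f j)) =
      eval_rel r (lattice_height (X i))%:R ((lattice_height (X j))%:R : R).
    move=> fd; have lt1 := ycoord_config_lt fd d2 Xij.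
    have lt2 := ycoord_config_lt fd d2 Xji.
    case: r => /=; rewrite ?eq_le ?leNgt ?lt1 ?lt2 ?ltr_nat //.
  by rewrite !E ?eqxx.
- have [ij|ij] := eqVneq (X i) (X j).
    by rewrite /strictly_above !xcoord_point ij !eqxx.
  have [ik|ik] := eqVneq i k.
    by rewrite ik !strictly_above_det !subrr !(mulr0, mul0r, subrr) ltxx.
  have [jk|jk] := eqVneq j k.
    by rewrite jk !strictly_above_det !subrr !mul0r ltxx.
  have [det0|det0] := eqVneq (lattice_det (X i) (X j) (X k)) 0; last first.
    by rewrite !(det_config XB _ dB) ?eqxx.
  have [||a aP] := lattice_det_eq0 ij _ _ det0; rewrite ?(inj_eq Xinj) //.
  move=> _; exists i, j, k, a; split => //.
  by rewrite /= !inE negb_or -(inj_eq Xinj) ij ik jk.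
Qed.

(** * The family of configurations *)

Definition abscissa (L m : nat) (s : 'S_m) (i : 'I_(L.+1 + m)) : nat :=
  match fintype.split i with inl a => (a : nat).*2 | inr l => (s l : nat).*2.+1 end.

Lemma abscissa_lshift L m (s : 'S_m) (a : 'I_L.+1) :
  abscissa s (lshift m a) = (a : nat).*2.
Proof. by rewrite /abscissa (unsplitK (inl a)). Qed.

Lemma abscissa_rshift L m (s : 'S_m) (l : 'I_m) :
  abscissa s (rshift L.+1 l) = (s l : nat).*2.+1.
Proof. by rewrite /abscissa (unsplitK (inr l)). Qed.

Lemma abscissa_inj L m (s : 'S_m) : injective (@abscissa L m s).
Proof.
move=> i j; rewrite -[i]splitK -[j]splitK.
case: (fintype.split i) => a; case: (fintype.split j) => b /=;
  rewrite ?abscissa_lshift ?abscissa_rshift => ab.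
- by congr lshift; apply: val_inj => /=; lia.
- by exfalso; lia.
- by exfalso; lia.
- by congr rshift; apply: (@perm_inj _ s); apply: val_inj => /=; lia.
Qed.

Lemma abscissa_le L m (s : 'S_m) i : (m <= L)%N -> (@abscissa L m s i <= L.*2)%N.
Proof.
move=> mL; rewrite /abscissa; case: fintype.split => a; have := ltn_ord a; first lia.
by have := ltn_ord (s a); lia.
Qed.

(* Small enough that every determinant changes by less than 1. *)
Definition depth (R : realType) (L : nat) : R := (6%:R * L.+1%:R)^-1.

Lemma depth_gt0 (R : realType) (L : nat) : 0 < depth R L.
Proof. by rewrite invr_gt0 mulr_gt0 ?ltr0n. Qed.

Lemma depth_small (R : realType) (L : nat) : 3%:R * depth R L * L.*2%:R < 1.
Proof.
have L0 : 0 < L.+1%:R :> R by rewrite ltr0n.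
rewrite mulrAC ltr_pdivrMr ?mulr_gt0 ?ltr0n // -muln2 natrM -natr1; lra.
Qed.

Lemma depth_lt1 (R : realType) (L : nat) : depth R L < 1.
Proof.
rewrite invf_lt1 ?mulr_gt0 ?ltr0n //.
have : 1 <= L.+1%:R :> R by rewrite ler1n.
lra.
Qed.

Definition nested (R : realType) L m (s : 'S_m) : 'I_(L.+1 + m) -> 'rV[R]_2 :=
  config (abscissa s) (fun=> depth R L).

Definition pushed (R : realType) L m (s : 'S_m) (l : 'I_m) :
    'I_(L.+1 + m) -> 'rV[R]_2 :=
  config (abscissa s) (fun i => if i == rshift L.+1 l then - depth R L else depth R L).

Lemma config_lshift (R : realType) L m (s : 'S_m) (e : 'I_(L.+1 + m) -> R) a :
  config (abscissa s) e (lshift m a) = point ((a.*2)%:R) ((a.*2 ^ 2)%:R).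
Proof.
by rewrite /config abscissa_lshift /lattice_height odd_double addn0 mul0r addr0.
Qed.

Lemma config_rshift (R : realType) L m (s : 'S_m) (e : 'I_(L.+1 + m) -> R) l :
  config (abscissa s) e (rshift L.+1 l) =
  point ((s l).*2.+1%:R) (((s l).*2.+1 ^ 2).+1%:R + e (rshift L.+1 l)).
Proof.
by rewrite /config abscissa_rshift /lattice_height /= odd_double /= addn1 mul1r.
Qed.

(* The point lies between the midpoint of its edge and the top edge of the
   hull, which joins the first to the last vertex. *)
Lemma nested_inner (R : realType) L m (s : 'S_m) (l : 'I_m) :
  (1 < L)%N -> (m <= L)%N -> ~ hull_vertex (@nested R L m s) (rshift L.+1 l).
Proof.
move=> L1 mL; have sl := ltn_ord (s l).
pose v a := @nested R L m s (lshift m (inord a)).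
have hv a : convex_hull (range (@nested R L m s)) (v a).
  by apply: convex_hull_in; exists (lshift m (inord a)).
have vE a : (a <= L)%N -> v a = point ((a.*2)%:R) ((a.*2 ^ 2)%:R).
  by move=> aL; rewrite /v /nested config_lshift inordK.
set r : R := (s l)%:R; have r0 : 0 <= r by rewrite ler0n.
have rL : r + 1 <= L%:R by rewrite natr1 ler_nat; lia.
have L2 : 2 <= L%:R :> R by rewrite ler_nat.
have dbl k : (k.*2)%:R = 2 * k%:R :> R by rewrite -mul2n natrM.
have odE : (s l).*2.+1%:R = 2 * r + 1 by rewrite -natr1 dbl.
have evE : (s l).+1.*2%:R = 2 * r + 2 by rewrite dbl -natr1 -/r; ring.
(* The weight for which the point on the top edge, from (0, 0) to (2 L, 4 L^2), has abscissa 2 r +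
   1. *)
pose t : R := 1 - (2 * r + 1) / (2 * L%:R).
have t01 : 0 <= t <= 1.
  rewrite subr_ge0 gerBl divr_ge0 ?ler_pdivrMr; lra.
apply: (@not_hull_vertex_between _ _ _ _
   (2^-1 *: v (s l) + (1 - 2^-1) *: v (s l).+1) (t *: v 0%N + (1 - t) *: v L)).
- by apply: convex_hull_conv => //; rewrite invr_ge0 ler0n invf_le1 ?ler1n.
- exact: convex_hull_conv.
- rewrite /nested config_rshift point_conv !vE ?xcoord_point; try lia.
  by rewrite odE evE dbl -/r; field.
- rewrite /nested config_rshift point_conv !vE ?xcoord_point; try lia.
  by rewrite odE !dbl /t; field; lra.
- rewrite /nested config_rshift !point_conv !vE ?ycoord_point; try lia.
  rewrite -[(_ ^ 2).+1%:R]natr1 !natrX odE evE !dbl -/r.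
  have := depth_gt0 R L; have := depth_lt1 R L.
  set d := depth R L => d1 d0; apply/andP; split; first by nra.
  (* The top edge lies on y = 2 L x with 2 L >= 2 r + 2; for r = 0 the strict inequality needs L >=
     2. *)
  rewrite (_ : t * _ + _ = (2 * r + 1) * (2 * L%:R)); last by rewrite /t; field; lra.
  by nra.
Qed.

Lemma nested_promise (R : realType) L m (s : 'S_m) :
  (1 < L)%N -> (m <= L)%N -> convex_hull_promise (@nested R L m s).
Proof.
move=> L1 mL i j; rewrite -[i]splitK -[j]splitK.
case: (fintype.split i) => a; last by move=> /nested_inner; case.
case: (fintype.split j) => b; last by move=> _ /nested_inner; case.
by move=> _ _; rewrite /nested !config_lshift !xcoord_point ltr_nat /=; lia.
Qed.

(* The pushed point lies to the left of the last vertex and has a larger index;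
   it is exposed in the direction of the tangent to the parabola. *)
Lemma pushed_not_promise (R : realType) L m (s : 'S_m) (l : 'I_m) :
  (m <= L)%N -> ~ convex_hull_promise (@pushed R L m s l).
Proof.
move=> mL; have sl := ltn_ord (s l).
have d0 := depth_gt0 R L; have d1 := depth_lt1 R L.
have vL : hull_vertex (@pushed R L m s l) (lshift m ord_max).
  (* The last vertex is the unique rightmost point. *)
  apply: (@hull_vertex_support _ _ _ _ (-1) 0) => j.
  rewrite -(inj_eq (@abscissa_inj L m s)) => ne.
  rewrite !mul0r !addr0 !xcoord_point !mulN1r ltrN2 ltr_nat.
  by move: ne (abscissa_le s j mL); rewrite abscissa_lshift /=; lia.
have vq : hull_vertex (@pushed R L m s l) (rshift L.+1 l).
  set q := rshift L.+1 l.
  apply: (@hull_vertex_support _ _ _ _ (- (2 * (s l).*2.+1%:R)) 1) => j jq.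
  rewrite /pushed {1 2}/q !config_rshift -/q eqxx !xcoord_point !ycoord_point.
  rewrite (negPf jq) !mul1r.
  have {jq} := contra_neq (@abscissa_inj L m s j q) jq.
  rewrite {1}/q abscissa_rshift; set x := abscissa s j => xq.
  set y := (s l).*2.+1 in xq *; set D := depth R L in d0 d1 *.
  (* The functional exceeds its value at the pushed point by (x - y)^2 + (1 + D) odd x - (1 - D),
     which is positive because x and y are distinct integers. *)
  have : 1 <= (x%:R - y%:R) ^+ 2 + (odd x)%:R :> R /\
         ((odd x)%:R = 1 :> R \/ (odd x)%:R = 0 :> R).
    split; last by case: (odd x); auto.
    have : x%:Z - y%:Z != 0 by lia.
    move=> xy0; have : 1 <= (x%:Z - y%:Z) ^+ 2 by rewrite -gtz0_ge1 exprn_even_gt0.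
    rewrite -(ler_int R) rmorphXn /= intrB => h; have := ler0n R (odd x); lra.
  rewrite -[(_ ^ 2).+1%:R]natr1 /lattice_height natrD !natrX.
  have := sqr_ge0 (x%:R - y%:R : R).
  by clearbody D; move: (x%:R : R) (y%:R : R) => u v sq [h [oE|oE]]; rewrite oE in h *; nra.
move=> /(_ _ _ vL vq) [/(_ _)].
rewrite /pushed config_lshift config_rshift !xcoord_point ltr_nat /=.
by move=> h _; have := h (ltac:(lia)); lia.
Qed.

(** * Counting *)

Definition edge_test L m (s : 'S_m) (l : 'I_m) : seq 'I_(L.+1 + m) :=
  [:: lshift m (inord (s l)); lshift m (inord (s l).+1); rshift L.+1 l].

(** A programme may test the triple in any of its orders. *)
Definition critical L m (s : 'S_m) (l : 'I_m) (c : comparison (L.+1 + m)) : bool :=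
  if c is Orientation i j k then perm_eq [:: i; j; k] (edge_test L s l) else false.

Lemma map_edge_test L m (s : 'S_m) (l : 'I_m) : (m <= L)%N ->
  map (abscissa s) (edge_test L s l) =
  [:: (s l : nat).*2; (s l : nat).*2.+2; (s l : nat).*2.+1].
Proof.
move=> mL; have sl := ltn_ord (s l).
by rewrite /= !abscissa_lshift abscissa_rshift !inordK //; lia.
Qed.

(** A differing answer comes from three distinct points at abscissas 2 a, 2 a + 1, 2 a + 2. One of
    them is [q_l], since nothing else moves, and its odd abscissa gives a = [s l]. *)
Lemma critical_comparison (R : realType) L m (s : 'S_m) (l : 'I_m)
    (c : comparison (L.+1 + m)) : (0 < L)%N -> (m <= L)%N ->
  eval_comparison (nested R s) c != eval_comparison (pushed R s l) c ->
  critical s l c.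
Proof.
move=> L0 mL ne; have d0 := ltW (depth_gt0 R L).
have [|||||i [j [k [a [cE ijk aX]]]]] :=
    eval_comparison_config _ _ _ _ _ (depth_small R L) ne.
- exact: abscissa_inj.
- by rewrite double_gt0.
- by move=> i; apply: abscissa_le.
- by move=> i; rewrite ger0_norm.
- by move=> i; case: ifP; rewrite ?normrN ger0_norm.
rewrite cE /critical.
have lP : rshift L.+1 l \in [:: i; j; k].
  apply: contraNT ne; rewrite cE /= !inE !negb_or => /and3P[il jl kl].
  by rewrite /pushed /config !(eq_sym _ (rshift _ _)) !(negPf il, negPf jl, negPf kl).
have Xijk := allP aX.
have aE : a = s l.
  have := Xijk _ (map_f (abscissa s) lP).
  by rewrite /= abscissa_rshift !inE; lia.
have sub : {subset [:: i; j; k] <= edge_test L s l}.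
  move=> x /(map_f (abscissa s)) /Xijk.
  rewrite -(mem_map (@abscissa_inj L m s)) (map_edge_test s l mL) -aE /=.
  by rewrite !inE orbCA orbC -orbA => /or3P[] ->; rewrite ?orbT.
have [_ eqi] := uniq_min_size ijk sub (leqnn 3).
by apply: uniq_perm => //; rewrite -(eq_uniq _ eqi).
Qed.

(** The index beyond the vertices reveals [l], and the two consecutive vertex indices reveal
    [s l]. *)
Lemma critical_inj L m (s s' : 'S_m) (l l' : 'I_m) (c : comparison (L.+1 + m)) :
  (m <= L)%N -> critical s l c -> critical s' l' c -> l = l' /\ s l = s' l'.
Proof.
move=> mL; case: c => //= i j k; rewrite perm_sym => sl s'l.
have {sl s'l}E := perm_trans sl s'l.
have ll' : l = l'.
  have : rshift L.+1 l \in edge_test L s' l' by rewrite -(perm_mem E) !inE eqxx !orbT.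
  by rewrite !inE !eq_rlshift /= => /eqP /rshift_inj.
split=> //; subst l'; have := perm_map (@nat_of_ord _) E.
have lt1 := ltn_ord (s l); have lt2 := ltn_ord (s' l).
rewrite /= !inordK; try lia.
move=> /perm_mem {}E; apply: val_inj => /=.
have := E (s l); have := E (s l).+1; rewrite !inE; lia.
Qed.

Lemma eval_map_noncritical (R : realType) L m (s : 'S_m) (l : 'I_m)
    (tr : seq (comparison (L.+1 + m))) : (0 < L)%N -> (m <= L)%N ->
  ~~ has (critical s l) tr ->
  [seq eval_comparison (nested R s) c | c <- tr] =
  [seq eval_comparison (pushed R s l) c | c <- tr].
Proof.
move=> L0 mL; elim: tr => //= c tr IH; rewrite negb_or => /andP[nc /IH ->].
by congr cons; apply/eqP; apply: contraNT nc; apply: critical_comparison.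
Qed.

(** Otherwise the run carries over to the configuration with [q_l] pushed out and gives the same
    answer, although the promise fails there. *)
Lemma has_critical (R : realType) L m (prog : programme (L.+1 + m)) (s : 'S_m)
    (l : 'I_m) b tr : (1 < L)%N -> (m <= L)%N ->
  decides_promise R prog ->
  exec_trace prog (nested R s) 0 (fun=> 0%N) b tr -> has (critical s l) tr.
Proof.
move=> L1 mL dec htr; apply: contraT => nc; exfalso.
have E := @eval_map_noncritical R _ _ _ _ _ (ltnW L1) mL nc.
have run1 := exec_trace_exec htr E.
have [b1 [k1 [ex1 b1P]]] := dec (pushed R s l).
have [b2 [k2 [ex2 b2P]]] := dec (nested R s).
apply: (@pushed_not_promise R L m s l mL); apply/b1P.
have [<- _] := exec_det run1 ex1.
have [-> _] := exec_det (exec_trace_exec htr erefl) ex2.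
by apply/b2P; apply: nested_promise.
Qed.

Lemma fact_le_comparisons (R : realType) L m (prog : programme (L.+1 + m)) :
  (1 < L)%N -> (m <= L)%N -> decides_promise R prog ->
  exists P b k, run prog (P : 'I_(L.+1 + m) -> 'rV[R]_2) b k /\ (m`! <= 5 ^ k)%N.
Proof.
move=> L1 mL dec.
have trP (s : 'S_m) : exists bt : bool * seq (comparison (L.+1 + m)),
    exec_trace prog (nested R s) 0 (fun=> 0%N) bt.1 bt.2.
  have [b [k [/exec_exec_trace[tr htr _] _]]] := dec (nested R s).
  by exists (b, tr).
have [bt btP] := choice trP.
have [s0 s0P] : {s0 | (\max_s size (bt s).2)%N = size (bt s0).2}.
  by apply: bigop.eq_bigmax; apply/card_gt0P; exists 1%g.
pose K := size (bt s0).2.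
have ltK s : (size (bt s).2 <= K)%N by rewrite /K -s0P (bigop.leq_bigmax s).
exists (nested R s0), (bt s0).1, K; split.
  exact: exec_trace_exec (btP s0) erefl.
pose code s := [seq (eval_comparison (nested R s) c,
                     [exists l, critical s l c]) | c <- (bt s).2].
(* Beyond the end of a shorter code [onth] yields [None], so each position takes 1 + 4 = 5
   values. *)
pose fcode s : {ffun 'I_K -> option (bool * bool)} := [ffun t : 'I_K => onth (code s) t].
have size_code s : size (code s) = size (bt s).2 by rewrite size_map.
suff fcode_inj : injective fcode.
  have := leq_card _ fcode_inj.
  by rewrite card_ffun card_option card_prod card_bool card_ord card_Sn.
move=> s s' /ffunP fE.
have {fE}cE : code s = code s'.
  apply: eq_from_onth_le => t; rewrite !size_code leq_max => ht.
  have tK : (t < K)%N by case/orP: ht => /leq_trans; apply.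
  by have := fE (Ordinal tK); rewrite !ffunE.
have bits (u : 'S_m) : [seq eval_comparison (nested R u) c | c <- (bt u).2] = unzip1 (code u).
  by rewrite /code /unzip1 -map_comp.
have trE : (bt s).2 = (bt s').2.
  by apply: exec_trace_inj (btP s) (btP s') _; rewrite !bits cE.
apply/perm.permP => l; have := has_critical l L1 mL dec (btP s).
have : [seq [exists l, critical s l c] | c <- (bt s).2] =
       [seq [exists l, critical s' l c] | c <- (bt s).2].
  have := congr1 unzip2 cE; rewrite /unzip2 /code -!map_comp trE; exact.
(* Both permutations now share trace and marks. A comparison critical for [l] under [s] is marked,
   hence critical for some [l'] under [s'], and [critical_inj] applies. *)
elim: (bt s).2 => //= c tr IH [cc ctr] /orP[sc|]; last exact: IH.
have /existsP[l' s'c] : [exists l, critical s' l c].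
  by rewrite -cc; apply/existsP; exists l.
by have [<-] := critical_inj mL sc s'c.
Qed.

(** * From the factorial to n log n *)

Lemma expn_le_fact h : (h ^ h <= (h.*2)`!)%N.
Proof.
(* Each new factor h + k + 1 of the factorial is at least h. *)
have main k : (h ^ k <= (h + k)`!)%N.
  elim: k => [|k IH]; first by rewrite addn0 fact_gt0.
  by rewrite addnS factS expnS leq_mul // leqW // leq_addr.
by rewrite -addnn.
Qed.

(** With h = [n %/ 6] one has n <= 12 h and n <= h^2, hence n ln n <= 24 h ln h <= 24 k ln 5 <= 96
    k, using the crude bound ln 5 <= 4. *)
Lemma comparisons_ge (R : realType) (n m k : nat) :
  (144 <= n)%N -> (n <= m.*2.+2)%N -> (m`! <= 5 ^ k)%N ->
  96^-1 * (n%:R * ln n%:R) <= k%:R :> R.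
Proof.
move=> n144 nm mk; pose h := (n %/ 6)%N.
have hn : (n <= 12 * h)%N by rewrite /h; lia.
have hm : (h.*2 <= m)%N by rewrite /h; lia.
have h0 : (0 < h)%N by lia.
have hk : (h ^ h <= 5 ^ k)%N.
  by apply: leq_trans mk; apply: leq_trans (expn_le_fact h) _; rewrite leq_fact.
have nh : (n <= h ^ 2)%N by nia.
have pos x : (0 < x)%N -> x%:R \is @Num.pos R by move=> x0; rewrite posrE ltr0n.
have lnh : ln n%:R <= 2%:R * ln h%:R :> R.
  rewrite mulr_natl -lnXn ?ltr0n // -natrX ler_ln ?pos ?ler_nat ?expn_gt0 ?h0 //; lia.
have lnk : h%:R * ln h%:R <= k%:R * ln 5%:R :> R.
  rewrite !mulr_natl -!lnXn ?ltr0n // -!natrX ler_ln ?pos ?ler_nat ?expn_gt0 ?h0 //.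
have ln5 : ln 5%:R <= 4%:R :> R.
  by rewrite (_ : 5%:R = 1 + 4%:R) ?le_ln1Dx //; lra.
have lnh0 : 0 <= ln h%:R :> R by rewrite ln_ge0 // ler1n.
have k0 : 0 <= k%:R :> R by rewrite ler0n.
have hn' : n%:R <= 12%:R * h%:R :> R by rewrite -natrM ler_nat.
have n0 : 0 <= n%:R :> R by rewrite ler0n.
have h0' : 0 <= h%:R :> R by rewrite ler0n.
have : n%:R * ln n%:R <= (12%:R * h%:R) * (2%:R * ln h%:R) :> R.
  by rewrite (le_trans (ler_wpM2l n0 lnh)) // ler_wpM2r // mulr_ge0.
have : k%:R * ln 5%:R <= k%:R * 4%:R :> R by rewrite ler_wpM2l.
lra.
Qed.

Theorem mainTheorem5 (R : realType) :
  exists (c : R) (N : nat), 0 < c /\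
    forall (n : nat) (prog : programme n), (N <= n)%N ->
      decides_promise R prog ->
      exists (P : 'I_n -> 'rV[R]_2) (answer : bool) (k : nat),
        run prog P answer k /\ c * (n%:R * ln n%:R) <= k%:R.
Proof.
exists 96^-1, 144%N; split; first by rewrite invr_gt0 ltr0n.
move=> n prog n144 dec.
(* The largest m for which n = L + 1 + m leaves an edge for each of the m points. *)
pose m := n.-1./2; pose L := (n.-1 - m)%N.
have L1 : (1 < L)%N by rewrite /L /m; lia.
have mL : (m <= L)%N by rewrite /L /m; lia.
have nm : (n <= m.*2.+2)%N by rewrite /m; lia.
have nE : n = (L.+1 + m)%N by rewrite /L /m; lia.
clearbody m L; subst n.
have [P [b [k [runP mk]]]] := fact_le_comparisons L1 mL dec.
by exists P, b, k; split=> //; apply: comparisons_ge mk.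
Qed.
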